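(* Let $\mathcal{H}=\mathcal{H}(\Omega)$ be a functional (reproducing kernel) Hilbert space on a nonempty set $\Omega$ and let $A,B\in\mathcal{B}(\mathcal{H})$. Let $f:(0,1)\to[0,\infty)$ be a function and $t\in(0,1)$. Then for any sub-multiplicative Orlicz function $\phi$, $$\begin{aligned}\phi\left(\mathbf{ber}^2(A^*B)\right)\le{}&\frac{1}{2(1+f(t))}\,\phi\left(\mathbf{ber}(A^*B)\right)\,\mathbf{ber}\left(\phi(|A|^2)+\phi(|B|^2)\right)\\&+\frac{f(t)}{2(1+f(t))}\left(\phi\left(\mathbf{ber}(|B|^2|A|^2)\right)+\frac12\,\mathbf{ber}\left(\phi(|A|^4)+\phi(|B|^4)\right)\right).\end{aligned}$$
   Context: A functional (reproducing kernel) Hilbert space $\mathcal{H}=\mathcal{H}(\Omega)$ is a Hilbert space of complex-valued functions on a nonempty set $\Omega$ such that for every $\lambda\in\Omega$ the evaluation $f\mapsto f(\lambda)$ is a continuous linear functional; $k_\lambda\in\mathcal{H}$ is the unique element with $f(\lambda)=\langle f,k_\lambda\rangle$ for all $f\in\mathcal{H}$. It is assumed that $k_\lambda\neq0$ for all $\lambda\in\Omega$, and $\hat{k}_\lambda=k_\lambda/\|k_\lambda\|$ is the normalized reproducing kernel. $\mathcal{B}(\mathcal{H})$ is the algebra of bounded linear operators on $\mathcal{H}$; $|A|=(A^*A)^{1/2}$. The Berezin number of $A\in\mathcal{B}(\mathcal{H})$ is $\mathbf{ber}(A)=\sup_{\lambda\in\Omega}|\langle A\hat{k}_\lambda,\hat{k}_\lambda\rangle|$,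 and $\mathbf{ber}^p(A)=(\mathbf{ber}(A))^p$. Functions of positive operators are taken in the continuous functional calculus. An Orlicz function is a function $\phi:[0,\infty)\to[0,\infty)$ that is continuous, convex and increasing, with $\phi(0)=0$ and $\phi(t)\to+\infty$ as $t\to+\infty$; it is sub-multiplicative if $\phi(xy)\le\phi(x)\phi(y)$ for all $x,y\ge0$. *)

(* Defs.v *)
From HB Require Import structures.
From mathcomp Require Import all_boot all_order all_algebra.
From mathcomp Require Import complex.
From mathcomp Require Import all_classical all_reals all_analysis.
Set Implicit Arguments.
Unset Strict Implicit.
Unset Printing Implicit Defensive.
Import Order.TTheory GRing.Theory Num.Theory.
Import numFieldNormedType.Exports.
Local Open Scope classical_set_scope.
Local Open Scope ring_scope.
Local Open Scope complex_scope.

(* A Hilbert space of complex-valued functions on Omega: an element u of the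
   complex Banach space fh_car stands for the function fh_eval u, and distinct
   elements are distinct functions.  The inner product is linear in its first
   argument and conjugate-linear in the second. *)
Record functional_hilbert (R : realType) (Omega : Type) := FunctionalHilbert {
  fh_car :> completeNormedModType R[i] ;
  fh_dot : {dot fh_car for Num.conj} ;
  fh_normE : forall u : fh_car, `|u| ^+ 2 = fh_dot u u ;
  fh_eval : fh_car -> Omega -> R[i] ;
  fh_eval_inj : injective fh_eval ;
  fh_eval_linear : forall l : Omega, scalar (fun u : fh_car => fh_eval u l) ;
  fh_eval_continuous : forall l : Omega,
    continuous (fun u : fh_car => fh_eval u l : R[i]^o)
}.

Section operators.
Context {R : realType} {Omega : Type} (H : functional_hilbert R Omega).
Implicit Types (T S : H -> H) (l : Omega).

Local Notation dot := (fh_dot H).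

Definition bounded_op T := linear T /\ continuous T.

(* Kernels, and adjoints of bounded operators, are the unique elements with the
   defining property; they exist by the Riesz representation theorem, so the
   default value of xget is never used for them. *)
Definition repr_kernel l : H := xget 0 [set k | forall u, fh_eval u l = dot u k].

Definition normalized_kernel l : H := `|repr_kernel l|^-1 *: repr_kernel l.

Definition adjoint T : H -> H :=
  xget (fun=> 0)
    [set S | bounded_op S /\ forall u v, dot (T u) v = dot u (S v)].

Definition ber T : R :=
  sup [set complex.Re `|dot (T (normalized_kernel l)) (normalized_kernel l)|
      | l in [set: Omega]].

Definition spectrum T : set R[i] :=
  [set z | ~ exists S, [/\ bounded_op S,
             (forall u, S (T u - z *: u) = u) &
             (forall u, T (S u) - z *: S u = u)]].

Definition poly_op (p : {poly R}) T : H -> H :=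
  fun u => \sum_(i < size p) (p`_i)%:C *: iter i T u.

(* S = g(T) in the continuous functional calculus of a self-adjoint operator T,
   for g continuous on the (real) spectrum of T: S is the limit in operator norm
   of p_n(T) for polynomials p_n converging to g uniformly on the spectrum.
   The values of g off the spectrum are irrelevant. *)
Definition is_cfc T (g : R -> R) S :=
  bounded_op S /\
  exists p : nat -> {poly R},
    (forall e : R, 0 < e -> \forall n \near \oo,
       forall x : R, spectrum T x%:C -> `|(p n).[x] - g x| <= e) /\
    (forall e : R, 0 < e -> \forall n \near \oo,
       forall u : H, `|poly_op (p n) T u - S u| <= e%:C * `|u|).

Definition cfc (g : R -> R) T : H -> H := xget (fun=> 0) [set S | is_cfc T g S].

Definition abs_op T : H -> H := cfc Num.sqrt (adjoint T \o T).

End operators.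

(* Functions on [0, +oo[ are represented by functions on R whose values at
   negative numbers are unconstrained. *)
Record orlicz (R : realType) (phi : R -> R) : Prop := Orlicz {
  orlicz_ge0 : forall x, 0 <= x -> 0 <= phi x ;
  orlicz_continuous : {within `[0, +oo[, continuous phi} ;
  orlicz_convex : @convex_function R R^o `[0, +oo[ phi ;
  orlicz_increasing : {in `[0, +oo[ &, {homo phi : x y / x <= y}} ;
  orlicz0 : phi 0 = 0 ;
  orlicz_pinfty : phi x @[x --> +oo] --> +oo
}.

Definition submultiplicative (R : realType) (phi : R -> R) :=
  forall x y, 0 <= x -> 0 <= y -> phi (x * y) <= phi x * phi y.

(* Main.v *)
Require Import Defs.
From HB Require Import structures.
From mathcomp Require Import all_boot all_order all_algebra.
From mathcomp Require Import complex.
From mathcomp Require Import all_classical all_reals all_analysis.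
From mathcomp Require Import ring lra.
Import Order.TTheory GRing.Theory Num.Theory.
Import numFieldNormedType.Exports.
Local Open Scope classical_set_scope.
Local Open Scope ring_scope.

(** Put [P = A^* A = |A|^2] and [Q = B^* B = |B|^2], and let [x] be a normalized
    kernel.  As [|<A^* B x, x>| <= |A x| |B x|], the number
    [|<A^* B x, x>|^2] is at most the mean, with weights [1 / (1 + f t)] and
    [f t / (1 + f t)], of [|<A^* B x, x>| |A x| |B x|] and [|A x|^2 |B x|^2].
    Here [|A x|^2 = <P x, x>] and [|B x|^2 = <Q x, x>], so that Buzano's
    inequality bounds the second term by
    [(|<Q P x, x>| + |P x| |Q x|) / 2], while [|P x|^2 = <|A|^4 x, x>] and
    [|Q x|^2 = <|B|^4 x, x>].  Convexity and sub-multiplicativity of [phi], the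
    inequality between arithmetic and geometric means, and Jensen's inequality
    [phi (<T x, x>) <= <phi(T) x, x>] ([cfc_jensen]) then bound
    [phi (|<A^* B x, x>|^2)] by the right-hand side; the supremum over [x] is
    taken by continuity of [phi] ([orlicz_sqr_sup]).

    Three facts from operator theory carry this.
    - Adjoints exist ([adjointP]) by the Riesz representation theorem, which is
      proved by minimising a quadratic functional ([riesz_below]).  The same
      minimisation shows that [T - x], for [T] self-adjoint and [x] real, is
      invertible as soon as it is bounded below ([spectrum_realP]).
    - A real polynomial [p] that is nonnegative on the spectrum of a
      self-adjoint [T] satisfies [p(T) >= 0] ([poly_op_ge0]): the infimum [m]
      of the numerical range of [p(T)] is an approximate eigenvalue, and
      factoring [p - m] over the complex numbers yields a point of the spectrum
      of [T] at which [p] takes the value [m].  Hence [p(T)] has norm at most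
      the supremum of [|p|] on the spectrum ([poly_op_norm]).
    - With the Weierstrass approximation theorem ([weierstrass]) this provides
      the functional calculus of a positive operator ([cfcP]), the identity
      [(sqrt T)^2 = T] ([is_cfc_sqrtK]), and the comparison of [g(T)] with
      [q(T)] for an affine function [q <= g] ([cfc_ge_poly]).  Jensen's
      inequality is this comparison for a supporting line of [phi]. *)

(** * Polynomial approximation of continuous functions *)

(** The [n]-th Bernstein polynomial of the sequence of nodal values [F], defined
    by de Casteljau's recursion: its value at [x] is the mean of [F k] when [k]
    is binomial with parameters [n] and [x]. *)
Fixpoint bernstein {R : realType} n (F : nat -> R) : {poly R} :=
  if n is n'.+1
  then 'X * bernstein n' (fun k => F k.+1) + (1 - 'X) * bernstein n' F
  else (F 0%N)%:P.

Lemma bernsteinS {R : realType} n (F : nat -> R) x :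
  (bernstein n.+1 F).[x] =
  x * (bernstein n (fun k => F k.+1)).[x] + (1 - x) * (bernstein n F).[x].
Proof. by rewrite /= !hornerE. Qed.

Lemma bernstein_affine {R : realType} n (F : nat -> R) (a c x : R) :
  (bernstein n (fun k => a * F k + c)).[x] = a * (bernstein n F).[x] + c.
Proof.
elim: n F => [|n IH] F; first by rewrite !hornerE.
by rewrite !bernsteinS !IH; ring.
Qed.

Lemma le_bernstein {R : realType} n (F G : nat -> R) (x : R) : 0 <= x <= 1 ->
  (forall k, (k <= n)%N -> F k <= G k) ->
  (bernstein n F).[x] <= (bernstein n G).[x].
Proof.
move=> x01; elim: n F G => [|n IH] F G FG; first by rewrite /= !hornerE FG.
have [x0 x1] := andP x01.
rewrite !bernsteinS lerD// ler_wpM2l ?subr_ge0// IH// => k kn; apply: FG => //.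
exact: leqW.
Qed.

(** The second moment of a binomial variable. *)
Lemma bernstein_sqr {R : realType} n (c x : R) :
  (bernstein n (fun k => (k%:R + c) ^+ 2)).[x] =
  n%:R * x * (1 - x) + (n%:R * x + c) ^+ 2.
Proof.
elim: n c => [|n IH] c; first by rewrite /= !hornerE; ring.
rewrite bernsteinS IH.
have -> : (fun k => (k.+1%:R + c) ^+ 2) =
    (fun k => (k%:R + (1 + c)) ^+ 2) :> (nat -> R).
  by apply/funext => k; rewrite -natr1 addrA.
by rewrite IH -natr1; ring.
Qed.

(** The Heine-Cantor theorem. *)
Lemma segment_unif_continuous {R : realType} (g : R -> R) (a b : R) :
  continuous g -> forall e : R, 0 < e -> exists2 d : R, 0 < d &
  forall x y : R, a <= x <= b -> `|y - x| < d -> `|g y - g x| <= e.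
Proof.
move=> cg e e0.
have /compact_near_coveringP cov := @segment_compact R a b.
have [|d] := cov R (0:R)^'+ (fun d x => forall y, `|y - x| < d ->
  `|g y - g x| <= e) _.
  move=> x _.
  have /cvgrPdist_lt /(_ (e / 2)) := cg x.
  move=> /(_ (divr_gt0 e0 (ltr0Sn _ 1))) /nbhs_ballP [r /= r0 Hr].
  exists (ball x (r / 2), [set d | 0 < d < r / 2]) => /=.
    split; first by apply: nbhsx_ballx; rewrite divr_gt0.
    near=> d; apply/andP; split => //.
    near: d; apply: nbhs_right_lt; rewrite divr_gt0 //.
  move=> [x' d] /= [xx' /andP[d0 dr]] y yx'.
  have h1 : `|g x - g x'| < e / 2.
    apply: Hr; rewrite /ball /= in xx' *; apply: lt_trans xx' _; lra.
  have h2 : `|g x - g y| < e / 2.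
    apply: Hr; rewrite /ball /= in xx' *.
    have := ler_distD x' x y; rewrite (distrC x' y); lra.
  have := ler_distD (g x) (g y) (g x'); rewrite (distrC (g y) (g x)); lra.
move=> /= d0 H.
exists (d / 2); first by rewrite divr_gt0.
move=> x y xab yx; apply: (H (d / 2)) => //.
- by rewrite /= sub0r normrN gtr0_norm; lra.
- by lra.
Unshelve. all: by end_near. Qed.

(** Bernstein's proof: a bound of [|g y - g x|] by [e / 2 + K (y - x)^2] is
    averaged over the binomial distribution. *)
Lemma weierstrass01 {R : realType} (g : R -> R) : continuous g ->
  forall e : R, 0 < e -> exists p : {poly R}, forall x : R, 0 <= x <= 1 ->
    `|p.[x] - g x| <= e.
Proof.
move=> cg e e0.
have [d d0 Hd] := @segment_unif_continuous R g 0 1 cg (e / 2) (divr_gt0 e0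
  (ltr0Sn _ 1)).
have [M M0 HM] : exists2 M : R, 0 <= M & forall x, 0 <= x <= 1 -> `|g x| <= M.
  have [c _ Hc] := @EVT_max R (fun x => `|g x|) 0 1 ler01
    (continuous_subspaceT (fun x =>
      continuous_comp (cg x) (@norm_continuous _ R^o (g x)))).
  by exists `|g c|.
pose K := 2 * M / d ^+ 2.
have K0 : 0 <= K by rewrite divr_ge0 ?sqr_ge0// mulr_ge0.
(* Uniform continuity when [|y - x| < d], the bound [2 M] otherwise. *)
have gK x y : 0 <= x <= 1 -> 0 <= y <= 1 ->
  `|g y - g x| <= e / 2 + K * (y - x) ^+ 2.
  move=> x01 y01; case: (ltP `|y - x| d) => yxd.
    have := Hd x y x01 yxd; have := mulr_ge0 K0 (sqr_ge0 (y - x)); lra.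
  have h : 2 * M <= K * (y - x) ^+ 2.
    rewrite -[leLHS]mulr1 /K -[leRHS]mulrA ler_wpM2l ?mulr_ge0//.
    rewrite -(@ler_pM2l _ (d ^+ 2)) ?exprn_gt0// mulrA mulfV ?mul1r ?mulr1;
      last first.
      by rewrite gt_eqF ?exprn_gt0.
    by rewrite -[leRHS]real_normK ?num_real// lerXn2r ?nnegrE ?normr_ge0// ltW.
  have := ler_normB (g y) (g x); have := HM x x01; have := HM y y01; lra.
pose n := (Num.truncn (2 * K / e)).+1.
have n0 : 0 < n%:R :> R by rewrite ltr0n.
have nK : K / n%:R <= e / 2.
  rewrite ler_pdivrMr//.
  have : 2 * K / e <= n%:R by apply/ltW/truncnS_gt.
  by rewrite ler_pdivrMr//; lra.
exists (bernstein n (fun k => g (k%:R / n%:R))) => x x01.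
(* The mean of the bound given by [gK] at the nodes: the variance of
   [k / n] is [x (1 - x) / n]. *)
pose V k := (k%:R + - (n%:R * x)) ^+ 2.
have E : (bernstein n (fun k => K / n%:R ^+ 2 * V k + e / 2)).[x] <= e.
  rewrite bernstein_affine bernstein_sqr subrr expr0n /= addr0.
  have -> : K / n%:R ^+ 2 * (n%:R * x * (1 - x)) = K / n%:R * (x * (1 - x)).
    by field; rewrite gt_eqF.
  have : K / n%:R * (x * (1 - x)) <= K / n%:R.
    by rewrite ler_piMr ?divr_ge0 ?(ltW n0)//; nra.
  lra.
pose G k := g (k%:R / n%:R).
have GV k : (k <= n)%N -> `|G k - g x| <= K / n%:R ^+ 2 * V k + e / 2.
  move=> kn.
  have kn01 : 0 <= (k%:R / n%:R : R) <= 1.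
    by rewrite divr_ge0//= ler_pdivrMr// mul1r ler_nat.
  apply: le_trans (gK x _ x01 kn01) _.
  rewrite le_eqVlt; apply/orP; left; apply/eqP.
  by rewrite /V; field; rewrite gt_eqF.
have GD : (bernstein n G).[x] - g x = (bernstein n (fun k =>
  1 * G k - g x)).[x].
  by rewrite bernstein_affine; ring.
have GN : g x - (bernstein n G).[x] =
    (bernstein n (fun k => (-1) * G k + g x)).[x].
  by rewrite bernstein_affine; ring.
rewrite ler_norml -/G; apply/andP; split.
  rewrite lerNl opprB GN; apply: le_trans E; apply: le_bernstein => // k /GV.
  by rewrite ler_norml => /andP[? ?]; lra.
rewrite GD; apply: le_trans E; apply: le_bernstein => // k /GV.
by rewrite ler_norml => /andP[? ?]; lra.
Qed.

Lemma weierstrass {R : realType} (g : R -> R) (b : R) : 0 < b -> continuous g ->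
  forall e : R, 0 < e -> exists p : {poly R}, forall x : R, 0 <= x <= b ->
    `|p.[x] - g x| <= e.
Proof.
move=> b0 cg e e0.
have cgb : continuous (fun x => g (b * x)).
  move=> x; apply: continuous_comp; last exact: cg.
  exact: mulrl_continuous.
have [p Hp] := weierstrass01 _ cgb e e0.
exists (p \Po (b^-1 *: 'X)) => x /andP[x0 xb].
rewrite horner_comp !hornerE; have := Hp (b^-1 * x).
rewrite mulrA mulfV ?gt_eqF// mul1r; apply.
by rewrite mulr_ge0 ?invr_ge0 ?(ltW b0)//= mulrC ler_pdivrMr// mul1r.
Qed.

(** The even extension of a function that is continuous on the half-line is
    continuous. *)
Lemma continuous_half_line {R : realType} (g : R -> R) :
  {within `[0, +oo[, continuous g} -> continuous (fun x : R => g `|x|).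
Proof.
move=> cg x; apply/(@cvgrPdist_lt _ R^o) => e e0.
have /subspace_continuousP/(_ `|x|) := cg.
rewrite /= in_itv /= andbT => /(_ (normr_ge0 x)) /(@cvgrPdist_lt _ R^o)/(_ e
  e0).
rewrite /within /= => h.
apply: (@filterS _ (nbhs (x : R)) _ _ _ _ (@norm_continuous _ R^o x _ h)) =>
  y /=.
by apply; rewrite in_itv /= andbT.
Qed.


(** * Inner product and norm *)

Section inner_product.
Local Open Scope complex_scope.
Context {R : realType} {Omega : Type} (H : functional_hilbert R Omega).
Implicit Types (u v w : H) (T S P Q : H -> H) (a : R) (c : R[i]).

Local Notation dot := (fh_dot H).

(** The norm and the real part of the inner product, as real numbers. *)
Definition nrm u : R := complex.Re `|u|.
Definition rdot u v : R := complex.Re (dot u v).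

Lemma Re_normc_ge0 c : 0 <= complex.Re `|c|.
Proof. by rewrite normc_def /= sqrtr_ge0. Qed.

Lemma nrmE u : `|u| = (nrm u)%:C.
Proof. by rewrite /nrm RRe_real// normr_real. Qed.

Lemma nrm_ge0 u : 0 <= nrm u.
Proof. by rewrite -ler0c -nrmE. Qed.

Lemma nrm_sqr u : nrm u ^+ 2 = rdot u u.
Proof.
have := fh_normE u; rewrite nrmE /rdot => <-.
by rewrite -rmorphXn.
Qed.

Lemma rdot_ge0 u : 0 <= rdot u u.
Proof. by rewrite -nrm_sqr sqr_ge0. Qed.

Lemma nrm0 : nrm 0 = 0.
Proof. by rewrite /nrm normr0. Qed.

Lemma nrm_eq0 u : (nrm u == 0) = (u == 0).
Proof. by rewrite -[RHS]normr_eq0 nrmE -(inj_eq (@complexI R)). Qed.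

Lemma nrm_gt0 u : (0 < nrm u) = (u != 0).
Proof. by rewrite lt_def nrm_ge0 nrm_eq0 andbT. Qed.

Lemma nrmD u v : nrm (u + v) <= nrm u + nrm v.
Proof. by rewrite -lecR rmorphD /= -!nrmE ler_normD. Qed.

Lemma nrmN u : nrm (- u) = nrm u.
Proof. by rewrite /nrm normrN. Qed.

Lemma nrmZC c u : nrm (c *: u) = complex.Re `|c| * nrm u.
Proof.
by apply: complexI; rewrite -nrmE normrZ [RHS]rmorphM /= RRe_real ?normr_real//
  nrmE.
Qed.

Lemma nrmZ a u : nrm (a%:C *: u) = `|a| * nrm u.
Proof. by rewrite nrmZC normc_def /= expr0n /= addr0 sqrtr_sqr. Qed.

Lemma dotDl u v w : dot (u + v) w = dot u w + dot v w.
Proof. exact: linearDl. Qed.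
Lemma dotDr u v w : dot u (v + w) = dot u v + dot u w.
Proof. exact: linearDr. Qed.
Lemma dotNl u v : dot (- u) v = - dot u v.
Proof. exact: linearNl. Qed.
Lemma dotNr u v : dot u (- v) = - dot u v.
Proof. exact: linearNr. Qed.
Lemma dotZl c u v : dot (c *: u) v = c * dot u v.
Proof. exact: linearZl_LR. Qed.
Lemma dotZr c u v : dot u (c *: v) = c^* * dot u v.
Proof. exact: linearZr_LR. Qed.
Lemma dotZr_real a u v : dot u (a%:C *: v) = a%:C * dot u v.
Proof. by rewrite dotZr; congr (_ * _); exact: conjc_real. Qed.
Lemma dotC u v : dot u v = (dot v u)^*.
Proof. by rewrite hermC expr0 mul1r. Qed.

Lemma rdotDl u v w : rdot (u + v) w = rdot u w + rdot v w.
Proof. by rewrite /rdot dotDl raddfD. Qed.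
Lemma rdotDr u v w : rdot u (v + w) = rdot u v + rdot u w.
Proof. by rewrite /rdot dotDr raddfD. Qed.
Lemma rdotNl u v : rdot (- u) v = - rdot u v.
Proof. by rewrite /rdot dotNl raddfN. Qed.
Lemma rdotNr u v : rdot u (- v) = - rdot u v.
Proof. by rewrite /rdot dotNr raddfN. Qed.
Lemma rdotZl a u v : rdot (a%:C *: u) v = a * rdot u v.
Proof. by rewrite /rdot dotZl; case: (dot u v) => x y;
  rewrite /= mul0r subr0. Qed.
Lemma rdotC u v : rdot u v = rdot v u.
Proof. by rewrite /rdot dotC; case: (dot v u). Qed.
Lemma rdotZr a u v : rdot u (a%:C *: v) = a * rdot u v.
Proof. by rewrite rdotC rdotZl rdotC. Qed.
Lemma rdot0l u : rdot 0 u = 0.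
Proof. by rewrite -(subrr u) rdotDl rdotNl subrr. Qed.
Lemma rdot0r u : rdot u 0 = 0.
Proof. by rewrite rdotC rdot0l. Qed.

End inner_product.

(** * Bounded operators and the Riesz representation *)

Section bounded_operators.
Local Open Scope complex_scope.
Context {R : realType} {Omega : Type} {H : functional_hilbert R Omega}.
Implicit Types (u v w : H) (T S P Q : H -> H) (a : R) (c : R[i]).

Local Notation dot := (fh_dot H).
Local Notation nrm := (nrm H).
Local Notation rdot := (rdot H).

Lemma rdot_le u v : rdot u v <= nrm u * nrm v.
Proof.
have [->|u0] := eqVneq u 0; first by rewrite rdot0l nrm0 mul0r.
have [->|v0] := eqVneq v 0; first by rewrite rdot0r nrm0 mulr0.
have uv : 0 < nrm u * nrm v by rewrite mulr_gt0// nrm_gt0.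
rewrite -(ler_pM2r uv).
have := rdot_ge0 H ((nrm v)%:C *: u - (nrm u)%:C *: v).
rewrite !(rdotDl, rdotDr, rdotNl, rdotNr, rdotZl,
  rdotZr) (rdotC H v u) -!nrm_sqr.
by set x := nrm u; set y := nrm v; set z := rdot u v; nra.
Qed.

Lemma normr_rdot_le u v : `|rdot u v| <= nrm u * nrm v.
Proof.
rewrite ler_norml rdot_le andbT lerNl -rdotNl -[X in _ <= X * _](nrmN H).
exact: rdot_le.
Qed.

(** The complex inequality is the real one for [c u] and [v], where the phase
    [c] makes the inner product real and nonnegative. *)
Lemma cauchy_schwarz u v : complex.Re `|dot u v| <= nrm u * nrm v.
Proof.
have [->|d0] := eqVneq (dot u v) 0; first by rewrite normr0 mulr_ge0 ?nrm_ge0.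
pose c := (dot u v)^* / `|dot u v|.
have c1 : `|c| = 1.
  by rewrite normrM normfV normr_id normcJ mulfV// normr_eq0.
have -> : `|dot u v| = dot (c *: u) v.
  rewrite dotZl /c mulrAC [_^* * _]mulrC -sqr_normc expr2 mulfK// normr_eq0 //.
apply: le_trans (rdot_le _ _) _.
by rewrite nrmZC c1 mul1r.
Qed.

Lemma rdot_le_normc u v : rdot u v <= complex.Re `|dot u v|.
Proof.
by have := normc_ge_Re (dot u v); rewrite normc_def lecR;
  exact/le_trans/ler_norm.
Qed.

(** A linear operator is continuous exactly when it has a finite norm. *)
Lemma bounded_opP T : bounded_op T <->
  linear T /\ exists2 M : R, 0 <= M & forall u, nrm (T u) <= M * nrm u.
Proof.
split=> -[lT].
  pose Tl : {linear H -> H} := HB.pack T (GRing.isLinear.Build _ _ _ _ T lT).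
  move=> /(@linear_bounded_continuous _ _ _ Tl)/linear_boundedP/pinfty_ex_gt0[M
    M0 HM].
  split=> //; exists (complex.Re M);
    first by rewrite -ler0c RRe_real ?gtr0_real// ltW.
  move=> u; have := HM u.
  by rewrite -{1}(RRe_real (gtr0_real M0)) !nrmE -rmorphM lecR.
move=> [M M0 HM]; split=> //.
pose Tl : {linear H -> H} := HB.pack T (GRing.isLinear.Build _ _ _ _ T lT).
apply/(@linear_bounded_continuous _ _ _ Tl)/linear_boundedP.
exists M%:C; split; first by rewrite ger0_real// ler0c.
move=> r Mr u; apply: (@le_trans _ _ (M%:C * `|u|)); last first.
  by rewrite ler_wpM2r// ltW.
by rewrite !nrmE -rmorphM lecR.
Qed.

Section linear_maps.
Context {T : H -> H} (lT : linear T).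

Lemma lin0 : T 0 = 0.
Proof.
have := lT 1 0 0; rewrite !scale1r addr0 => /eqP.
by rewrite -subr_eq0 opprD addrA subrr sub0r oppr_eq0 => /eqP.
Qed.
Lemma linZ c u : T (c *: u) = c *: T u.
Proof. by rewrite -[c *: u]addr0 lT lin0 addr0. Qed.
Lemma linD u v : T (u + v) = T u + T v.
Proof. by rewrite -[u]scale1r lT !scale1r. Qed.
Lemma linN u : T (- u) = - T u.
Proof. by rewrite -scaleN1r linZ scaleN1r. Qed.
Lemma linB u v : T (u - v) = T u - T v.
Proof. by rewrite linD linN. Qed.
End linear_maps.

Lemma hilbert_complete (x : nat -> H) :
  (forall e : R, 0 < e -> exists N, forall m n, (N <= m)%N -> (N <= n)%N ->
     nrm (x m - x n) < e) ->
  exists l, forall e : R, 0 < e -> \forall n \near \oo, nrm (x n - l) < e.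
Proof.
move=> cx; have /cauchy_cvg/cvg_ex[l Hl] : cauchy (x @ \oo).
  apply/cauchy_exP => e e0; have eR : (complex.Re e)%:C =
    e by rewrite RRe_real ?gtr0_real.
  have [|N HN] := cx (complex.Re e); first by rewrite -ltcR eR.
  exists (x N); exists N => // n /= Nn.
  by rewrite -ball_normE /ball_ /= -eR nrmE ltcR HN//=.
exists l => e e0; move/cvgrPdist_lt : Hl => /(_ e%:C).
rewrite ltcR => /(_ e0); apply: filterS => n.
by rewrite nrmE ltcR -(nrmN H) opprB.
Qed.

(** The first-order condition at a minimum of a quadratic function. *)
Lemma quadratic_ge0_eq0 (d q : R) : 0 <= q ->
  (forall s, 0 <= 2 * s * d + s ^+ 2 * q) -> d = 0.
Proof.
move=> q0 /(_ (- d / (q + 1))).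
have q1 : 0 < q + 1 by lra.
have -> : 2 * (- d / (q + 1)) * d + (- d / (q + 1)) ^+ 2 * q =
  - (d ^+ 2 * (q + 2)) / (q + 1) ^+ 2 by field; rewrite gt_eqF.
rewrite pmulr_lge0 ?invr_gt0 ?exprn_gt0// => h.
apply/eqP; rewrite -sqrf_eq0; apply/eqP/le_anti; rewrite sqr_ge0 andbT.
have := sqr_ge0 d; nra.
Qed.

(** The Riesz representation theorem for the inner product [<P u, P w>], which
    is equivalent to the given one when [P] is bounded and bounded below: the
    functional [J u = |P u|^2 - 2 Re (f u)] is bounded below, its minimising
    sequences are Cauchy, and [u0] is the limit of one of them. *)
Lemma riesz_below (P : H -> H) (f : H -> R[i]) (d K : R) :
  bounded_op P -> 0 < d -> (forall u, d * nrm u <= nrm (P u)) ->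
  (forall c u v, f (c *: u + v) = c * f u + f v) ->
  0 <= K -> (forall u, complex.Re `|f u| <= K * nrm u) ->
  exists u0, forall w, f w = dot (P w) (P u0).
Proof.
move=> /bounded_opP[lP [M M0 HM]] d0 Hd lf K0 HK.
have f0 : f 0 = 0.
  have := lf 1 0 0; rewrite scale1r addr0 mul1r => /eqP.
  by rewrite -subr_eq0 opprD addrA subrr sub0r oppr_eq0 => /eqP.
have fZ c u : f (c *: u) = c * f u by rewrite -[c *: u]addr0 lf f0 addr0.
have fD u v : f (u + v) = f u + f v by rewrite -[u]scale1r lf scale1r mul1r.
pose g u : R := complex.Re (f u).
have gD u v : g (u + v) = g u + g v by rewrite /g fD raddfD.
have gZ a u : g (a%:C *: u) = a * g u.
  by rewrite /g fZ; case: (f u) => x y /=; rewrite mul0r subr0.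
have gle u : g u <= K * nrm u.
  apply: le_trans (HK u); have := normc_ge_Re (f u); rewrite normc_def lecR.
  exact/le_trans/ler_norm.
pose J u : R := rdot (P u) (P u) - 2 * g u.
have Jge u : - (K / d) ^+ 2 <= J u.
  rewrite /J -nrm_sqr.
  have h : g u <= K / d * nrm (P u).
    apply: le_trans (gle u) _; rewrite -mulrA ler_wpM2l// mulrC ler_pdivlMr//
      mulrC.
    exact: Hd.
  have := sqr_ge0 (nrm (P u) - K / d); set y := K / d in h *; nra.
have JD u v (s : R) : J (u + s%:C *: v) = J u + 2 * s * (rdot (P u) (P v) - g v)
     + s ^+ 2 * rdot (P v) (P v).
  rewrite /J gD gZ (linD lP) (linZ lP) !(rdotDl, rdotDr, rdotZl,
    rdotZr) (rdotC H (P v)).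
  ring.
pose A := range J.
have iA : has_inf A.
  split; first by exists (J 0); exists 0.
  by exists (- (K / d) ^+ 2) => _ [u _ <-].
have lbA u : inf A <= J u by apply: ge_inf => //; [case: iA|exists u].
have ex n : exists u, J u < inf A + n.+1%:R^-1.
  have [|_ [u _ <-] hu] := @inf_adherent _ A n.+1%:R^-1 _ iA; last by exists u.
  by rewrite invr_gt0.
have /choice[x Hx] := ex.
have xN (e : R) : 0 < e -> exists N, forall n, (N <= n)%N ->
  J (x n) < inf A + e.
  move=> e0; exists (Num.truncn e^-1) => n Nn.
  apply: lt_le_trans (Hx n) _; rewrite lerD2l invf_ple ?posrE//.
  apply: ltW; apply: lt_le_trans (truncnS_gt _) _; rewrite ler_nat ltnS //.
have [|u0 Hu0] := @hilbert_complete x.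
  move=> e e0; have de0 : 0 < d * e by rewrite mulr_gt0.
  have [|N HN] := xN ((d * e) ^+ 2 / 4); first by rewrite divr_gt0// exprn_gt0.
  exists N => m n /HN Hm /HN Hn; pose w := x m - x n.
  (* The midpoint of [x n] and [x m] has [J] at least [inf A], so that
     [|P w|^2 / 2 <= J (x m) + J (x n) - 2 inf A]. *)
  have h1 := JD (x n) w 1; have h2 := JD (x n) w (1 / 2).
  have := lbA (x n + (1 / 2)%:C *: w).
  have E1 : x n + 1%:C *: w = x m by rewrite scale1r /w addrC subrK.
  rewrite E1 in h1; rewrite {}h2 -nrm_sqr => h2; rewrite -nrm_sqr in h1.
  suff : d * nrm w < d * e by rewrite ltr_pM2l.
  apply: le_lt_trans (Hd w) _; rewrite -(@ltr_pXn2r _ 2) ?nnegrE ?nrm_ge0 ?(ltW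
    de0)//.
  set q := nrm (P w) ^+ 2 in h1 h2 *; set D := _ - g w in h1 h2; lra.
(* [J] at [x n + s w] is at least [inf A]; this is the limit in [n]. *)
have Hg w (s : R) : 0 <= 2 * s * (rdot (P u0) (P w) - g w) +
  s ^+ 2 * rdot (P w) (P w).
  rewrite leNgt; apply/negP => h.
  set X := _ + _ in h.
  pose L := `|2 * s| * (M * nrm (P w)).
  have L0 : 0 <= L by rewrite !mulr_ge0 ?normr_ge0 ?nrm_ge0.
  have e0 : 0 < - X / 4 by lra.
  have eL : 0 < - X / 4 / (L + 1) by rewrite divr_gt0//; lra.
  have [N HN] := xN _ e0.
  near \oo => n.
  have Nn : (N <= n)%N by near: n; exists N.
  have nu : nrm (x n - u0) < - X / 4 / (L + 1) by near: n; exact: Hu0.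
  have := lbA (x n + s%:C *: w); rewrite JD; have := HN _ Nn.
  have E2 : rdot (P (x n)) (P w) = rdot (P u0) (P w) +
    rdot (P (x n - u0)) (P w).
    by rewrite (linB lP) rdotDl rdotNl; ring.
  have h3 : `|2 * s| * `|rdot (P (x n - u0)) (P w)| <= - X / 4.
    apply: (@le_trans _ _ (L * nrm (x n - u0))).
      rewrite /L -mulrA ler_wpM2l// mulrAC.
      apply: le_trans (normr_rdot_le _ _) _; rewrite ler_wpM2r ?nrm_ge0//.
    have L1 : 0 < L + 1 by lra.
    have nu1 : nrm (x n - u0) * (L + 1) < - X / 4 by rewrite -ltr_pdivlMr.
    have := nrm_ge0 H (x n - u0); nra.
  have := ler_norm (2 * s * rdot (P (x n - u0)) (P w)); rewrite normrM.
  have XE : X = 2 * s * (rdot (P u0) (P w) - g w) +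
    s ^+ 2 * rdot (P w) (P w) by [].
  rewrite E2; move: h3 XE; clearbody X; lra.
have gE w : g w = rdot (P w) (P u0).
  apply/eqP; rewrite eq_sym -subr_eq0 rdotC; apply/eqP.
  exact: quadratic_ge0_eq0 (rdot_ge0 _ _) (Hg w).
(* The imaginary parts agree because the real parts do at [i w]. *)
exists u0 => w.
have := gE ('i *: w); have := gE w.
rewrite /g /rdot fZ (linZ lP) dotZl.
case: (f w) => x1 y1; case: (dot _ _) => x2 y2 /=.
rewrite !mul0r !sub0r !mul1r => -> /eqP; rewrite eqr_opp => /eqP ->.
by [].
Unshelve. all: by end_near. Qed.

(** Riesz representation. *)
Lemma riesz (f : H -> R[i]) (K : R) :
  (forall c u v, f (c *: u + v) = c * f u + f v) ->
  0 <= K -> (forall u, complex.Re `|f u| <= K * nrm u) ->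
  exists u0, forall w, f w = dot w u0.
Proof.
move=> lf K0 HK; apply: (@riesz_below id f 1 K) => //.
- by apply/bounded_opP; split=> //; exists 1 => // u; rewrite mul1r.
- by move=> u; rewrite mul1r.
Qed.

Lemma dot_inj u v : (forall w, dot w u = dot w v) -> u = v.
Proof.
move=> h; apply/eqP; rewrite -subr_eq0 -nrm_eq0 -sqrf_eq0 nrm_sqr; apply/eqP.
by rewrite /rdot dotDr h -dotDr subrr; exact: rdot0r.
Qed.

(** Bounded operators have adjoints, so the default value in the definition of
    [adjoint] is not used for them. *)
Lemma adjointP T : bounded_op T ->
  bounded_op (adjoint T) /\ forall u v, dot (T u) v = dot u (adjoint T v).
Proof.
move=> /bounded_opP[lT [M M0 HM]].
rewrite /adjoint; case: xgetP => [S _ []//|noS]; exfalso.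
have ex v : exists w, forall u, dot (T u) v = dot u w.
  apply: (@riesz (fun u => dot (T u) v) (M * nrm v)).
  - by move=> c u w; rewrite lT dotDl dotZl.
  - by rewrite mulr_ge0// nrm_ge0.
  - move=> u; apply: le_trans (cauchy_schwarz _ _) _.
    by rewrite mulrAC ler_wpM2r// nrm_ge0.
have /choice[S HS] := ex.
apply: (noS S); split=> //; apply/bounded_opP; split.
  move=> c u v; apply: dot_inj => w.
  by rewrite -HS !dotDr !dotZr -!HS.
exists M => // v.
have [->|Sv0] := eqVneq (nrm (S v)) 0; first by rewrite mulr_ge0// nrm_ge0.
have Sv : 0 < nrm (S v) by rewrite lt_def Sv0 nrm_ge0.
rewrite -(ler_pM2l Sv) -expr2 nrm_sqr /rdot -HS.
apply: le_trans (rdot_le _ _) _.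
by rewrite mulrCA mulrA ler_wpM2r ?nrm_ge0.
Qed.

End bounded_operators.

(** * Polynomials and spectrum of a self-adjoint operator *)

Section self_adjoint_operators.
Local Open Scope complex_scope.
Context {R : realType} {Omega : Type} {H : functional_hilbert R Omega}.
Implicit Types (u v w : H) (T S P Q : H -> H) (a : R) (c : R[i]).

Local Notation dot := (fh_dot H).
Local Notation nrm := (nrm H).
Local Notation rdot := (rdot H).

(** Symmetric operators; the bounded ones are the self-adjoint ones. *)
Definition self_adjoint T := forall u v, dot (T u) v = dot u (T v).

(** Injectivity with a bounded inverse on the range. *)
Definition bounded_below T :=
  exists2 d : R, 0 < d & forall u, d * nrm u <= nrm (T u).

Lemma bounded_op_linear {T} : bounded_op T -> linear T. Proof. by case. Qed.

Lemma bounded_op_comp T S : bounded_op T -> bounded_op S -> bounded_op (T \o S).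
Proof.
move=> /bounded_opP[lT [M M0 HM]] /bounded_opP[lS [N N0 HN]].
apply/bounded_opP; split; first by move=> c u v /=; rewrite lS lT.
exists (M * N); first exact: mulr_ge0.
by move=> u /=; apply: le_trans (HM _) _; rewrite -mulrA ler_wpM2l.
Qed.

Lemma bounded_op_lin T S c : bounded_op T -> bounded_op S ->
  bounded_op (fun u => T u + c *: S u).
Proof.
move=> /bounded_opP[lT [M M0 HM]] /bounded_opP[lS [N N0 HN]].
have c0 : 0 <= complex.Re `|c| by rewrite normc_def /= sqrtr_ge0.
apply/bounded_opP; split.
  by move=> b u v /=; rewrite lS lT !scalerDr !scalerA [c * b]mulrC addrACA.
exists (M + complex.Re `|c| * N); first by rewrite addr_ge0// mulr_ge0.
move=> u /=; apply: le_trans (nrmD _ _ _) _.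
by rewrite nrmZC mulrDl lerD// -mulrA ler_wpM2l.
Qed.

Lemma bounded_op_id : bounded_op (id : H -> H).
Proof. by apply/bounded_opP; split=> //; exists 1 => // u; rewrite mul1r. Qed.

Lemma bounded_op0 : bounded_op (fun _ : H => 0 : H).
Proof.
apply/bounded_opP; split; first by move=> c u v; rewrite scaler0 addr0.
by exists 0 => // u; rewrite nrm0 mul0r.
Qed.

Lemma bounded_op_shift T c : bounded_op T -> bounded_op (fun u => T u - c *: u).
Proof.
move=> bT; have := bounded_op_lin T id (- c) bT bounded_op_id.
by congr bounded_op; apply/funext => u; rewrite scaleNr.
Qed.

Lemma rdot_self_adjoint T u v : self_adjoint T -> rdot (T u) v = rdot u (T v).
Proof. by move=> sT; rewrite /rdot sT. Qed.

(** ** Polynomials in an operator *)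

(** The value of a complex polynomial at an operator. *)
Definition cpoly_op (p : {poly R[i]}) T u : H :=
  \sum_(i < size p) p`_i *: iter i T u.

Lemma poly_opE (p : {poly R}) T : poly_op p T =
  cpoly_op (map_poly (real_complex R) p) T.
Proof.
apply/funext => u; rewrite /poly_op /cpoly_op size_map_poly.
by apply: eq_bigr => i _; rewrite coef_map.
Qed.

Lemma cpoly_op_wide n (p : {poly R[i]}) T u : (size p <= n)%N ->
  cpoly_op p T u = \sum_(i < n) p`_i *: iter i T u.
Proof.
move=> pn; rewrite /cpoly_op -!(big_mkord xpredT (fun i => p`_i *: iter i T u)).
rewrite (big_cat_nat (n := size p) _ pn)//= [X in _ = _ + X]big_nat.
rewrite [X in _ = _ + X]big1 ?addr0// => i /andP[pi _].
by rewrite nth_default// scale0r.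
Qed.

Lemma cpoly_opD (p q : {poly R[i]}) T u :
  cpoly_op (p + q) T u = cpoly_op p T u + cpoly_op q T u.
Proof.
pose n := maxn (size p) (size q).
rewrite (@cpoly_op_wide n (p + q)) ?size_polyD//.
rewrite (@cpoly_op_wide n p) ?leq_maxl// (@cpoly_op_wide n q) ?leq_maxr//.
by rewrite -big_split; apply: eq_bigr => i _; rewrite coefD scalerDl.
Qed.

Lemma cpoly_opZ c (p : {poly R[i]}) T u : cpoly_op (c *: p) T u =
  c *: cpoly_op p T u.
Proof.
rewrite !(@cpoly_op_wide (size p))// ?size_scale_leq// scaler_sumr.
by apply: eq_bigr => i _; rewrite coefZ scalerA.
Qed.

Lemma cpoly_op0 T u : cpoly_op 0 T u = 0.
Proof. by rewrite /cpoly_op size_poly0 big_ord0. Qed.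

Lemma cpoly_op1 T u : cpoly_op 1 T u = u.
Proof. by rewrite /cpoly_op size_poly1 big_ord1 coef1 /= scale1r. Qed.

Lemma cpoly_opC c T u : cpoly_op c%:P T u = c *: u.
Proof. by rewrite -alg_polyC cpoly_opZ cpoly_op1. Qed.

Lemma cpoly_opMX (p : {poly R[i]}) T u : linear T ->
  cpoly_op (p * 'X) T u = T (cpoly_op p T u).
Proof.
move=> lT; rewrite (@cpoly_op_wide (size p).+1); last first.
  by rewrite (leq_trans (size_polyMleq _ _))// size_polyX addn2.
rewrite big_ord_recl coefMX /= scale0r add0r /cpoly_op.
rewrite (big_morph T (linD lT) (lin0 lT)); apply: eq_bigr => i _.
by rewrite coefMX /= (linZ lT).
Qed.

Lemma cpoly_opM (p q : {poly R[i]}) T u : linear T ->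
  cpoly_op (p * q) T u = cpoly_op p T (cpoly_op q T u).
Proof.
move=> lT; elim/poly_ind: p => [|p c IH]; first by rewrite mul0r !cpoly_op0.
rewrite mulrDl mulrAC mul_polyC !cpoly_opD !cpoly_opMX// IH cpoly_opZ.
by rewrite cpoly_opC.
Qed.

Lemma cpoly_opX T u : linear T -> cpoly_op 'X T u = T u.
Proof. by move=> lT; rewrite -['X]mul1r cpoly_opMX// cpoly_op1. Qed.

Lemma bounded_cpoly_op (p : {poly R[i]}) T : bounded_op T ->
  bounded_op (cpoly_op p T).
Proof.
move=> bT; elim/poly_ind: p => [|p c IH].
  have -> : cpoly_op 0 T = fun=> 0 by apply/funext => u; rewrite cpoly_op0.
  exact: bounded_op0.
have -> : cpoly_op (p * 'X + c%:P) T = fun u =>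
  (T \o cpoly_op p T) u + c *: id u.
  by apply/funext => u; rewrite cpoly_opD cpoly_opMX ?cpoly_opC//; case: bT.
by apply: bounded_op_lin bounded_op_id; exact: bounded_op_comp.
Qed.

Lemma bounded_poly_op (p : {poly R}) T : bounded_op T ->
  bounded_op (poly_op p T).
Proof. by rewrite poly_opE; exact: bounded_cpoly_op. Qed.

Lemma poly_opB (p q : {poly R}) T u :
  poly_op (p - q) T u = poly_op p T u - poly_op q T u.
Proof. by rewrite !poly_opE rmorphB /= cpoly_opD -[- map_poly _ _]scaleN1r
  cpoly_opZ scaleN1r. Qed.

Lemma poly_opM (p q : {poly R}) T u : linear T ->
  poly_op (p * q) T u = poly_op p T (poly_op q T u).
Proof. by move=> lT; rewrite !poly_opE rmorphM /= cpoly_opM. Qed.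

Lemma poly_opC a T u : poly_op a%:P T u = a%:C *: u.
Proof. by rewrite poly_opE map_polyC /= cpoly_opC. Qed.

Lemma poly_opX T u : linear T -> poly_op 'X T u = T u.
Proof. by move=> lT; rewrite poly_opE map_polyX cpoly_opX. Qed.

Lemma self_adjoint_poly_op (p : {poly R}) T : bounded_op T -> self_adjoint T ->
  self_adjoint (poly_op p T).
Proof.
move=> [lT _] sT; rewrite poly_opE; elim/poly_ind: p => [|p c IH] u v.
  by rewrite rmorph0 !cpoly_op0 linear0l linear0r.
rewrite rmorphD rmorphM /= map_polyX map_polyC /= !cpoly_opD !cpoly_opC.
rewrite dotDl dotDr dotZl dotZr_real; congr (_ + _).
by rewrite cpoly_opMX// sT IH cpoly_opM// cpoly_opX.
Qed.

(** An operator polynomial factors as its polynomial does. *)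
Lemma bounded_below_cpoly_op (p : {poly R[i]}) T : linear T -> p != 0 ->
  (forall z, root p z -> bounded_below (fun u => T u - z *: u)) ->
  bounded_below (cpoly_op p T).
Proof.
move=> lT p0; have [r pE] := closed_field_poly_normal p.
have lc : lead_coef p != 0 by rewrite lead_coef_eq0.
move: (lead_coef p) lc pE => l l0 -> hr.
have : bounded_below (cpoly_op (\prod_(z <- r) ('X - z%:P)) T).
  have : forall z, z \in r -> bounded_below (fun u => T u - z *: u).
    by move=> z zr; apply: hr; rewrite rootZ// root_prod_XsubC.
  elim: r {hr p0} => [|z r IH] hr.
    by exists 1 => // u; rewrite big_nil cpoly_op1 mul1r.
  have [|d d0 Hd] := IH; first by move=> y yr; apply: hr; rewrite inE yr orbT.
  have [|e e0 He] := hr z; first by rewrite inE eqxx.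
  exists (e * d); first exact: mulr_gt0.
  move=> u; rewrite big_cons cpoly_opM// cpoly_opD -polyCN cpoly_opC
    cpoly_opX//.
  rewrite scaleNr; apply: le_trans (He _); rewrite -mulrA ler_wpM2l// ltW//.
move=> [d d0 Hd]; exists (complex.Re `|l| * d).
  by rewrite mulr_gt0// -ltcR RRe_real ?normr_real// normr_gt0.
move=> u; rewrite cpoly_opZ nrmZC -mulrA ler_wpM2l//.
by rewrite normc_def /= sqrtr_ge0.
Qed.

(** ** The spectrum of a self-adjoint operator *)

(** [<(T - z) u, u>] has imaginary part [- Im z |u|^2]. *)
Lemma bounded_below_nonreal T (z : R[i]) : self_adjoint T ->
  z \isn't Num.real -> bounded_below (fun u => T u - z *: u).
Proof.
move=> sT; case: z => x y; rewrite complex_real => y0.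
exists `|y|; first by rewrite normr_gt0.
move=> u; have [->|u0] := eqVneq u 0.
  by rewrite nrm0 mulr0 nrm_ge0.
rewrite -(@ler_pM2r _ (nrm u)) ?nrm_gt0//.
apply: le_trans (cauchy_schwarz _ _); rewrite dotDl dotNl dotZl.
have -> : dot u u = (nrm u ^+ 2)%:C by rewrite -fh_normE nrmE rmorphXn.
have := sT u u; rewrite [RHS](dotC H); case: (dot (T u) u) => a b [ab].
rewrite normc_def /= -mulrA -expr2 -[X in `|_| * X]ger0_norm ?sqr_ge0//.
rewrite -normrM -sqrtr_sqr ler_sqrt ?addr_ge0 ?sqr_ge0//.
have -> : b = 0 by lra.
set n := nrm u; have := sqr_ge0 (a - (x * n ^+ 2 - y * 0)); lra.
Qed.

(** For a real number [x] and a self-adjoint [T], the equation [(T - x)^2 u = v]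
    is solved by minimisation, so that [T - x] is onto once it is bounded
    below. *)
Lemma spectrum_realP T x : bounded_op T -> self_adjoint T ->
  spectrum T x%:C <-> ~ bounded_below (fun u => T u - x%:C *: u).
Proof.
move=> bT sT; pose P u := T u - x%:C *: u.
have bP : bounded_op P by exact: bounded_op_shift.
have sP : self_adjoint P.
  by move=> u v; rewrite /P dotDl dotNl dotDr dotNr dotZl dotZr_real sT.
rewrite /spectrum/=; split=> h1 h2; apply: h1.
  have [d d0 Hd] := h2; have [lP _] := bP.
  have ex v : exists u, P (P u) = v.
    have [|||u0 Hu] := @riesz_below _ _ H P (fun w =>
      dot w v) d (nrm v) bP d0 Hd.
    - by move=> c u w; rewrite dotDl dotZl.
    - exact: nrm_ge0.
    - by move=> u; rewrite mulrC cauchy_schwarz.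
    by exists u0; apply: dot_inj => w; rewrite -sP Hu.
  have /choice[G HG] := ex.
  have Pinj u v : P u = P v -> u = v.
    move=> uv; apply/eqP; rewrite -subr_eq0 -nrm_eq0; apply/eqP/le_anti.
    rewrite nrm_ge0 andbT -(pmulr_rle0 _ d0); apply: le_trans (Hd _) _.
    by rewrite -/(P (u - v)) (linB lP) uv subrr nrm0.
  have PS u : P (P (G u)) = u by [].
  have SP u : P (G (P u)) = u by apply: Pinj; rewrite HG.
  exists (P \o G); split=> //=; apply/bounded_opP; split.
    by move=> c u v /=; apply: Pinj; rewrite lP !PS.
  exists d^-1; first by rewrite invr_ge0 ltW.
  by move=> u /=; rewrite mulrC ler_pdivlMr// mulrC; have := Hd (P (G u));
    rewrite -/(P _) PS.
case: h2 => S [/bounded_opP[lS [M M0 HM]] SP PS].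
exists (M + 1)^-1; first by rewrite invr_gt0; lra.
move=> u; rewrite mulrC ler_pdivrMr; last lra.
rewrite -[X in nrm X <= _]SP; apply: le_trans (HM _) _;
  rewrite mulrDr mulr1 mulrC.
by rewrite lerDl nrm_ge0.
Qed.

(** The infimum of the numerical range of a self-adjoint operator is an
    approximate eigenvalue: if [P = Q - m >= 0] then [|P u|^2 <= K <P u, u>]. *)
Lemma numerical_range_inf Q u0 : bounded_op Q -> self_adjoint Q -> u0 != 0 ->
  exists2 m : R, (forall u, m * nrm u ^+ 2 <= rdot (Q u) u) &
    ~ bounded_below (fun u => Q u - m%:C *: u).
Proof.
move=> bQ sQ u00.
have [lQ [K K0 HK]] := (bounded_opP _).1 bQ.
pose A := [set rdot (Q u) u / nrm u ^+ 2 | u in [set u | u != 0]].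
have Qge u : - K * nrm u ^+ 2 <= rdot (Q u) u.
  rewrite mulNr lerNl -rdotNl; apply: le_trans (rdot_le _ _) _.
  by rewrite nrmN expr2 mulrA ler_wpM2r ?nrm_ge0.
have iA : has_inf A.
  split; first by exists (rdot (Q u0) u0 / nrm u0 ^+ 2); exists u0.
  exists (- K) => _ [u /= u0' <-].
  by rewrite ler_pdivlMr ?exprn_gt0 ?nrm_gt0.
pose m := inf A.
have mle u : m * nrm u ^+ 2 <= rdot (Q u) u.
  have [->|un0] := eqVneq u 0; first by rewrite nrm0 expr0n /= mulr0 rdot0r.
  rewrite -ler_pdivlMr ?exprn_gt0 ?nrm_gt0//.
  by apply: ge_inf; [case: iA|exists u].
exists m => // -[d d0 Hd].
pose P u := Q u - m%:C *: u.
have bP : bounded_op P by exact: bounded_op_shift.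
have [lP [L L0 HL]] := (bounded_opP _).1 bP.
have PE u v : rdot (P u) v = rdot (Q u) v - m * rdot u v.
  by rewrite /P rdotDl rdotNl rdotZl.
have sP u v : rdot (P u) v = rdot u (P v).
  rewrite PE [RHS]rdotC PE (rdotC H v u) (rdot_self_adjoint _ _ _ sQ).
  by rewrite (rdotC H u (Q v)).
have {}Hd u : d * nrm u <= nrm (P u) by exact: Hd.
clearbody P.
have Pge u : 0 <= rdot (P u) u by rewrite PE -nrm_sqr subr_ge0.
have L1 : 0 < L + 1 by lra.
(* Positivity of [P] at [u - (L + 1)^-1 P u]. *)
have key u : nrm (P u) ^+ 2 <= (L + 1) * rdot (P u) u.
  have := Pge (u - ((L + 1)^-1)%:C *: P u).
  rewrite (linB lP) (linZ lP) !(rdotDl, rdotDr, rdotNl, rdotNr, rdotZl, rdotZr).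
  have -> : rdot (P (P u)) u = nrm (P u) ^+ 2.
    by rewrite sP nrm_sqr.
  rewrite -nrm_sqr; have : rdot (P (P u)) (P u) <= (L + 1) * nrm (P u) ^+ 2.
    apply: le_trans (rdot_le _ _) _; rewrite expr2 mulrA ler_wpM2r ?nrm_ge0//.
    by apply: le_trans (HL _) _; rewrite ler_wpM2r ?nrm_ge0//; lra.
  set W := nrm (P u) ^+ 2; set X := rdot (P (P u)) _; set Y := rdot (P u) u =>
    h1 h2.
  rewrite -ler_pdivrMl//.
  have : (L + 1)^-1 * ((L + 1)^-1 * X) <= (L + 1)^-1 * W.
    rewrite ler_wpM2l ?invr_ge0 ?(ltW L1)// ler_pdivrMl//.
  set s := (L + 1)^-1 in h2 *; lra.
have : m + d ^+ 2 / (L + 1) <= m.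
  apply: lb_le_inf; first by case: iA.
  move=> _ [u /= un0 <-]; rewrite ler_pdivlMr ?exprn_gt0 ?nrm_gt0//.
  have h1 : d ^+ 2 * nrm u ^+ 2 <= nrm (P u) ^+ 2.
    by rewrite -exprMn lerXn2r ?nnegrE ?mulr_ge0 ?nrm_ge0 ?(ltW d0)// Hd.
  rewrite mulrDl -lerBrDl mulrAC ler_pdivrMr//.
  have := le_trans h1 (key u); rewrite PE -nrm_sqr; lra.
have : 0 < d ^+ 2 / (L + 1) by rewrite divr_gt0 ?exprn_gt0.
lra.
Qed.

(** A polynomial that is nonnegative on the spectrum of a self-adjoint operator
    [T] is a positive operator at [T]: the infimum [m] of the numerical range of
    [p(T)] is an approximate eigenvalue, so one of the roots [z] of [p - m] is
    in the spectrum of [T]; then [z] is real and [p z = m]. *)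
Lemma poly_op_ge0 (p : {poly R}) T u : bounded_op T -> self_adjoint T ->
  (forall x : R, spectrum T x%:C -> 0 <= p.[x]) -> 0 <= rdot (poly_op p T u) u.
Proof.
move=> bT sT Hp; have [->|u0] := eqVneq u 0; first by rewrite rdot0r.
have bp := bounded_poly_op p T bT.
have [m mle nb] := numerical_range_inf _ _ bp (self_adjoint_poly_op p T bT sT)
  u0.
apply: le_trans (mle u); rewrite mulr_ge0 ?exprn_ge0 ?nrm_ge0//.
have [pm|pm] := eqVneq (p - m%:P) 0.
  (* [p] is the constant [m], which is nonnegative as the spectrum of [T] has a
     point, namely the infimum of the numerical range of [T]. *)
  have [m' _ nb'] := numerical_range_inf _ _ bT sT u0.
  have := Hp m' ((spectrum_realP _ _ bT sT).2 nb').
  by move/eqP: pm; rewrite subr_eq0 => /eqP->; rewrite hornerC.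
have [//|mneg] := leP 0 m; exfalso; apply: nb.
pose q := map_poly (real_complex R) (p - m%:P).
(* [p - m] at [T] is bounded below, since no root of it is in the spectrum. *)
have <- : cpoly_op q T = fun v => poly_op p T v - m%:C *: v.
  apply/funext => v; rewrite /q rmorphB /= map_polyC /= cpoly_opD -polyCN
    cpoly_opC.
  by rewrite poly_opE scaleNr.
apply: bounded_below_cpoly_op; first by case: bT.
  by rewrite map_poly_eq0.
move=> z rz; have [zr|zn] := boolP (z \is Num.real);
  last exact: bounded_below_nonreal.
move: rz; rewrite -(RRe_real zr); set x := complex.Re z.
rewrite /q fmorph_root /root !hornerE subr_eq0 => /eqP px.
apply: contrapT => nbz; have := Hp x ((spectrum_realP _ _ bT sT).2 nbz).
by rewrite px leNgt mneg.
Qed.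

(** [M^2 - p^2 >= 0] on the spectrum, hence [|p(T) u|^2 <= M^2 |u|^2]. *)
Lemma poly_op_norm (p : {poly R}) T (M : R) u : bounded_op T ->
  self_adjoint T ->
  0 <= M -> (forall x : R, spectrum T x%:C -> `|p.[x]| <= M) ->
  nrm (poly_op p T u) <= M * nrm u.
Proof.
move=> bT sT M0 HM; have lT := bounded_op_linear bT.
have := @poly_op_ge0 ((M ^+ 2)%:P - p * p) T u bT sT.
have -> : rdot (poly_op ((M ^+ 2)%:P - p * p) T u) u =
    M ^+ 2 * nrm u ^+ 2 - nrm (poly_op p T u) ^+ 2.
  rewrite poly_opB poly_opC poly_opM// rdotDl rdotNl rdotZl.
  by rewrite (rdot_self_adjoint _ _ _ (self_adjoint_poly_op p T bT sT))
    !nrm_sqr.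
rewrite subr_ge0 -exprMn => h.
rewrite -(@ler_pXn2r _ 2) ?nnegrE ?mulr_ge0 ?nrm_ge0//; apply: h => x /HM.
rewrite !hornerE -expr2 subr_ge0 -(real_normK (num_real p.[x])) => h.
by rewrite lerXn2r ?nnegrE.
Qed.

End self_adjoint_operators.

(** * Continuous functional calculus of positive operators *)

Section functional_calculus.
Local Open Scope complex_scope.
Context {R : realType} {Omega : Type} {H : functional_hilbert R Omega}.
Implicit Types (u v w : H) (T S P Q : H -> H) (a : R) (c : R[i]).

Local Notation dot := (fh_dot H).
Local Notation nrm := (nrm H).
Local Notation rdot := (rdot H).

(** Positivity of the quadratic form; self-adjointness is asked separately. *)
Definition positive_op T := forall u, 0 <= rdot (T u) u.

Lemma spectrum_ge0 T (x : R) : bounded_op T -> self_adjoint T ->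
  positive_op T ->
  spectrum T x%:C -> 0 <= x.
Proof.
move=> bT sT pT /(spectrum_realP _ _ bT sT) nb; rewrite leNgt; apply/negP => x0.
apply: nb; exists (- x); first by rewrite oppr_gt0.
move=> u; have [->|u0] := eqVneq u 0; first by rewrite nrm0 mulr0 nrm_ge0.
rewrite -(@ler_pM2r _ (nrm u)) ?nrm_gt0//; apply: le_trans (rdot_le _ _).
rewrite rdotDl rdotNl rdotZl -nrm_sqr -mulrA -expr2; have := pT u; lra.
Qed.

Lemma spectrum_le T (x K : R) : bounded_op T -> self_adjoint T ->
  (forall u, nrm (T u) <= K * nrm u) -> spectrum T x%:C -> x <= K.
Proof.
move=> bT sT HK /(spectrum_realP _ _ bT sT) nb; rewrite leNgt; apply/negP => xK.
apply: nb; exists (x - K); first by rewrite subr_gt0.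
move=> u; have := nrmD H (x%:C *: u - T u) (T u).
rewrite subrK nrmZ -(nrmN H (_ - _)) opprB mulrBl.
have : x * nrm u <= `|x| * nrm u by rewrite ler_wpM2r ?nrm_ge0 ?ler_norm.
have := HK u; lra.
Qed.

Lemma le0_small (x C : R) : (forall e : R, 0 < e -> e <= 1 -> x <= e * C) ->
  x <= 0.
Proof.
move=> h; rewrite leNgt; apply/negP => x0.
have C1 : 0 < `|C| + x + 1 by have := normr_ge0 C; lra.
have := h (x / (`|C| + x + 1)); rewrite divr_gt0// => /(_ isT).
rewrite ler_pdivrMr// mul1r => /(_ _)/wrap[]; first by have := normr_ge0 C; lra.
rewrite mulrAC ler_pdivlMr//; have := ler_norm C; nra.
Qed.

(** If [g] is a uniform limit of polynomials on the spectrum of [T], these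
    polynomials at [T] form a Cauchy sequence for the operator norm. *)
Lemma cfc_exists T (g : R -> R) : bounded_op T -> self_adjoint T ->
  (forall e : R, 0 < e -> exists p : {poly R},
     forall x : R, spectrum T x%:C -> `|p.[x] - g x| <= e) ->
  exists S, is_cfc T g S.
Proof.
move=> bT sT Hg; have lT := bounded_op_linear bT.
have gp n : exists p : {poly R},
    forall x : R, spectrum T x%:C -> `|p.[x] - g x| <= n.+1%:R^-1.
  by apply: Hg; rewrite invr_gt0.
have /choice[p Hp] := gp.
have pD m n u : nrm (poly_op (p m) T u - poly_op (p n) T u) <=
    (m.+1%:R^-1 + n.+1%:R^-1) * nrm u.
  have mn0 : 0 <= m.+1%:R^-1 + n.+1%:R^-1 :> R by rewrite addr_ge0 ?invr_ge0.
  rewrite -poly_opB; apply: poly_op_norm => // x Tx.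
  have -> : (p m - p n).[x] = ((p m).[x] - g x) - ((p n).[x] - g x).
    by rewrite !hornerE; ring.
  by apply: le_trans (ler_normB _ _) _; rewrite lerD// Hp.
have ninv (e : R) : 0 < e -> exists N, forall n, (N <= n)%N -> n.+1%:R^-1 <= e.
  move=> e0; exists (Num.truncn e^-1) => n Nn; rewrite invf_ple ?posrE//.
  by apply: ltW; apply: lt_le_trans (truncnS_gt _) _; rewrite ler_nat ltnS.
have ex u : exists l, forall e : R, 0 < e ->
    \forall n \near \oo, nrm (poly_op (p n) T u - l) < e.
  apply: hilbert_complete => e e0.
  have k0 : 0 < 2 * nrm u + 1 by have := nrm_ge0 H u; lra.
  have [N HN] := ninv (e / (2 * nrm u + 1)) (divr_gt0 e0 k0).
  exists N => m n /HN Hm /HN Hn; apply: le_lt_trans (pD m n u) _.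
  have := nrm_ge0 H u; set d := e / _ in Hm Hn.
  have : d * (2 * nrm u + 1) = e by rewrite divfK// gt_eqF.
  have : 0 < d by rewrite divr_gt0.
  move: Hm Hn; set x := _^-1; set y := _^-1; nra.
have /choice[S HS] := ex.
have pS n u : nrm (poly_op (p n) T u - S u) <= n.+1%:R^-1 * nrm u.
  rewrite -subr_le0; apply: (@le0_small _ (1 + nrm u)) => e e0 _.
  have [N HN] := ninv _ e0; near \oo => m.
  have h1 : m.+1%:R^-1 <= e by apply: HN; near: m; exists N.
  have h2 : nrm (poly_op (p m) T u - S u) < e by near: m; exact: HS.
  have := nrmD H (poly_op (p n) T u - poly_op (p m) T u) (poly_op (p m) T u - S
    u).
  rewrite addrA subrK; have := pD n m u; have := nrm_ge0 H u.
  move: h1 h2; set x := _^-1; set y := _^-1; nra.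
have lS : linear S.
  move=> c u v; apply/eqP; rewrite -subr_eq0 -nrm_eq0; apply/eqP/le_anti.
  rewrite nrm_ge0 andbT.
  apply: (@le0_small _ (nrm (c *: u + v) + complex.Re `|c| * nrm u + nrm v)) =>
    e e0 _.
  have [N /(_ N (leqnn _)) HN] := ninv _ e0.
  have [lp _] := bounded_poly_op (p N) T bT.
  have := pS N (c *: u + v); have := pS N u; have := pS N v.
  set q := poly_op (p N) T in lp *.
  have -> : S (c *: u + v) - (c *: S u + S v) =
    - (q (c *: u + v) - S (c *: u + v)) + (c *: (q u - S u) + (q v - S v)).
    by rewrite lp scalerBr opprB (addrACA (c *: q u)) -opprD addrA subrK.
  move=> h1 h2 h3.
  apply: le_trans (nrmD _ _ _) _; rewrite nrmN !mulrDr -addrA lerD//.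
    by apply: le_trans h3 _; rewrite ler_wpM2r ?nrm_ge0.
  apply: le_trans (nrmD _ _ _) _; rewrite nrmZC lerD//.
    rewrite mulrCA ler_wpM2l//; first by rewrite normc_def /= sqrtr_ge0.
    by apply: le_trans h2 _; rewrite ler_wpM2r ?nrm_ge0.
  by apply: le_trans h1 _; rewrite ler_wpM2r ?nrm_ge0.
exists S; split.
  apply/bounded_opP; split=> //.
  have [lp [M M0 HM]] := (bounded_opP _).1 (bounded_poly_op (p 0%N) T bT).
  exists (M + 1); first lra.
  move=> u; rewrite -[S u](subrK (poly_op (p 0%N) T u)).
  apply: le_trans (nrmD _ _ _) _; have := pS 0%N u; rewrite invr1 mul1r.
  by rewrite -(nrmN H) opprB; have := HM u; lra.
exists p; split=> e e0; have [N HN] := ninv _ e0; exists N => // n /= /HN h.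
  by move=> x Tx; apply: le_trans (Hp n x Tx) _.
move=> u; rewrite !nrmE -rmorphM lecR; apply: le_trans (pS n u) _.
by rewrite ler_wpM2r ?nrm_ge0.
Unshelve. all: by end_near. Qed.

Lemma is_cfc_approx T (g : R -> R) S (e : R) : is_cfc T g S -> 0 < e ->
  exists p : {poly R}, (forall x : R, spectrum T x%:C -> `|p.[x] - g x| <= e) /\
    forall u, nrm (poly_op p T u - S u) <= e * nrm u.
Proof.
move=> [_ [p [h1 h2]]] e0; near \oo => n.
exists (p n); split; first by near: n; exact: h1.
have : forall u, `|poly_op (p n) T u - S u| <= e%:C * `|u| by near: n;
  exact: h2.
by move=> h u; have := h u; rewrite !nrmE -rmorphM lecR.
Unshelve. all: by end_near. Qed.

(** The functional calculus is monotone, here with a polynomial as lower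
    bound. *)
Lemma cfc_ge_poly T (g : R -> R) S (q : {poly R}) u :
  bounded_op T -> self_adjoint T -> is_cfc T g S ->
  (forall x : R, spectrum T x%:C -> q.[x] <= g x) ->
  rdot (poly_op q T u) u <= rdot (S u) u.
Proof.
move=> bT sT gS qg; rewrite -subr_le0.
apply: (@le0_small _ (2 * nrm u ^+ 2)) => e e0 _.
have [p [h1 h2]] := is_cfc_approx _ _ _ _ gS e0.
have := @poly_op_ge0 _ _ _ (p - (q - e%:P)) T u bT sT.
rewrite !poly_opB poly_opC !(rdotDl, rdotNl) rdotZl -nrm_sqr => /(_ _)/wrap[].
  move=> x Tx; have := h1 x Tx; have := qg x Tx.
  by rewrite !hornerE ler_norml => h /andP[]; lra.
have := rdot_le (poly_op p T u - S u) u; rewrite rdotDl rdotNl => h3 h4.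
have : nrm (poly_op p T u - S u) * nrm u <= e * nrm u ^+ 2.
  by rewrite expr2 mulrA ler_wpM2r ?nrm_ge0.
lra.
Qed.

(** For a positive [T] and [g] continuous on the half-line, [g(T)] exists: the
    spectrum lies between [0] and a bound [K] of the norm of [T]. *)
Lemma cfcP T (g : R -> R) : bounded_op T -> self_adjoint T -> positive_op T ->
  {within `[0, +oo[, continuous g} -> is_cfc T g (cfc g T).
Proof.
move=> bT sT pT cg; have [lT [K K0 HK]] := (bounded_opP _).1 bT.
have [S HS] : exists S, is_cfc T g S.
  apply: cfc_exists => // e e0.
  have K1 : 0 < K + 1 by lra.
  have [p Hp] := weierstrass _ (K + 1) K1 (continuous_half_line _ cg) e e0.
  exists p => x Tx; have x0 := spectrum_ge0 _ _ bT sT pT Tx.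
  rewrite -[in g x](ger0_norm x0); apply: Hp; rewrite x0 /=.
  by have := spectrum_le _ _ _ bT sT HK Tx; lra.
by rewrite /cfc; case: xgetP => [//|/(_ S)].
Qed.

Lemma is_cfc_sqrtK T S : bounded_op T -> self_adjoint T -> positive_op T ->
  is_cfc T Num.sqrt S -> S \o S = T.
Proof.
move=> bT sT pT gS; apply/funext => u /=.
have [lT [K K0 HK]] := (bounded_opP _).1 bT.
have [lS [M M0 HM]] := (bounded_opP _).1 gS.1.
apply/eqP; rewrite -subr_eq0 -nrm_eq0; apply/eqP/le_anti; rewrite nrm_ge0 andbT.
apply: (@le0_small _ ((M + (M + 1) + (1 + 2 * Num.sqrt K)) * nrm u)) => e e0 e1.
have [p [h1 h2]] := is_cfc_approx _ _ _ _ gS e0.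
set q := poly_op p T in h2.
have qle v : nrm (q v) <= (M + 1) * nrm v.
  have := nrmD H (q v - S v) (S v); rewrite subrK.
  have := h2 v; have := HM v; have := nrm_ge0 H v; nra.
have E : S (S u) - T u = - (S (q u - S u)) + (- (q (q u) - S (q u)) +
  (q (q u) - T u)).
  by rewrite (linB lS) !opprB (addrA (S (q u) - _)) subrK addrA subrK.
rewrite E mulrA (mulrDr e) (mulrDl (e * _)) (mulrDr e M) (mulrDl (e * M))
  -addrA.
apply: le_trans (nrmD _ _ _) _; rewrite nrmN lerD//.
  apply: le_trans (HM _) _; rewrite -mulrA mulrCA ler_wpM2l//.
apply: le_trans (nrmD _ _ _) _; rewrite nrmN lerD//.
  by apply: le_trans (h2 _) _; rewrite -mulrA ler_wpM2l ?(ltW e0).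
rewrite /q -poly_opM// -(poly_opX T u lT) -poly_opB.
apply: poly_op_norm => //.
  by rewrite mulr_ge0 ?(ltW e0)//; have := sqrtr_ge0 K; lra.
move=> x Tx; have x0 := spectrum_ge0 _ _ bT sT pT Tx.
have xK := spectrum_le _ _ _ bT sT HK Tx.
have sx : Num.sqrt x <= Num.sqrt K by rewrite ler_wsqrtr.
have s0 := sqrtr_ge0 x.
rewrite hornerD hornerN hornerX hornerM -{3}(sqr_sqrtr x0).
have := h1 x Tx; set y : R := p.[x]; set s : R := Num.sqrt x in s0 sx * => ys.
have -> : y * y - s ^+ 2 = (y - s) * (y - s + 2 * s) by ring.
rewrite normrM ler_pM ?normr_ge0//.
by apply: le_trans (ler_normD _ _) _; rewrite lerD ?(le_trans ys)// ger0_norm;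
  lra.
Qed.

End functional_calculus.

(** * Orlicz functions *)

Section orlicz_functions.
Context {R : realType} {phi : R -> R} (ophi : orlicz phi).

Lemma orlicz_le x y : 0 <= x -> x <= y -> phi x <= phi y.
Proof.
move=> x0 xy; apply: (orlicz_increasing ophi) => //; rewrite in_itv /= andbT //.
exact: le_trans xy.
Qed.

Lemma orlicz_conv (s x y : R) : 0 <= s -> s <= 1 -> 0 <= x -> 0 <= y ->
  phi (s * x + (1 - s) * y) <= s * phi x + (1 - s) * phi y.
Proof.
move=> s0 s1 x0 y0.
have mem z : 0 <= z -> z \in (`[0, +oo[%classic : set R).
  by move=> z0; rewrite inE /= in_itv /= andbT.
exact: (orlicz_convex ophi (Itv01 s0 s1) (mem x x0) (mem y y0)).
Qed.

(** A convex function on the half-line lies above one of its supporting lines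
    at each point; at [0] the line is horizontal since [phi >= 0 = phi 0]. *)
Lemma orlicz_supporting_line (a : R) : 0 <= a ->
  exists c, forall x, 0 <= x -> phi a + c * (x - a) <= phi x.
Proof.
rewrite le_eqVlt => /predU1P[<-|a0].
  by exists 0 => x x0; rewrite mul0r addr0 (orlicz0 ophi); exact: orlicz_ge0.
have slope x y : 0 <= x -> x < a -> a < y ->
    (phi a - phi x) / (a - x) <= (phi y - phi a) / (y - a).
  move=> x0 xa ay; have ax : 0 < a - x by lra.
  have ya : 0 < y - a by lra.
  have yx : 0 < y - x by lra.
  have s0 : 0 <= (y - a) / (y - x) by rewrite divr_ge0 ?ltW.
  have s1 : (y - a) / (y - x) <= 1 by rewrite ler_pdivrMr// mul1r; lra.
  have := orlicz_conv _ x y s0 s1 x0 (ltW (le_lt_trans x0 (lt_trans xa ay))).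
  have -> : (y - a) / (y - x) * x + (1 - (y - a) / (y - x)) * y = a.
    by field; rewrite gt_eqF.
  have -> : (y - a) / (y - x) * phi x + (1 - (y - a) / (y - x)) * phi y =
    ((y - a) * phi x + (a - x) * phi y) / (y - x) by field; rewrite gt_eqF.
  rewrite ler_pdivlMr// ler_pdivrMr// mulrAC ler_pdivlMr//; nra.
pose A := [set (phi a - phi x) / (a - x) | x in [set x | 0 <= x < a]].
have A0 : A !=set0.
  by exists ((phi a - phi 0) / (a - 0)); exists 0 => //=; rewrite lexx.
have ubA y : a < y -> ubound A ((phi y - phi a) / (y - a)).
  by move=> ay _ [x /= /andP[x0 xa] <-]; exact: slope.
exists (sup A) => x x0; case: (ltgtP x a) => [xa|ax|->]; last first.
- by rewrite subrr mulr0 addr0.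
- have : sup A <= (phi x - phi a) / (x - a) by apply: ge_sup => //; exact: ubA.
  by rewrite ler_pdivlMr ?subr_gt0//; lra.
- have : (phi a - phi x) / (a - x) <= sup A.
    apply: ub_le_sup; last by exists x => //=; rewrite x0.
    by exists ((phi (a + 1) - phi a) / (a + 1 - a)); apply: ubA; lra.
  by rewrite ler_pdivrMr ?subr_gt0//; lra.
Qed.

End orlicz_functions.

Lemma orlicz_mean {R : realType} (phi : R -> R) (x y : R) : orlicz phi ->
  0 <= x -> 0 <= y -> phi (x * y) <= 1 / 2 * (phi (x ^+ 2) + phi (y ^+ 2)).
Proof.
move=> ophi x0 y0.
have xy : x * y <= 1 / 2 * x ^+ 2 + (1 - 1 / 2) * y ^+ 2.
  have := sqr_ge0 (x - y); nra.
apply: le_trans (orlicz_le ophi _ _ (mulr_ge0 x0 y0) xy) _.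
apply: le_trans (orlicz_conv ophi (1/2) _ _ _ _ (sqr_ge0 x) (sqr_ge0 y)) _; lra.
Qed.

(** A bound of [phi (x^2)] on a set holds at its supremum, by continuity. *)
Lemma orlicz_sqr_sup {R : realType} (phi : R -> R) (E : set R) (r : R) :
  orlicz phi -> has_sup E -> (forall x, E x -> 0 <= x) ->
  (forall x, E x -> phi (x ^+ 2) <= r) -> phi (sup E ^+ 2) <= r.
Proof.
move=> ophi sE E0 Er; rewrite leNgt; apply/negP => rlt.
have c : continuous (fun x : R => phi `|x ^+ 2|).
  move=> x; apply: (@continuous_comp _ _ _ (fun x : R => x ^+ 2) (fun x : R =>
    phi `|x|)).
    exact: exprn_continuous.
  exact: (continuous_half_line _ (orlicz_continuous ophi)).
have e0 : 0 < phi (sup E ^+ 2) - r by rewrite subr_gt0.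
have /(@cvgrPdist_lt _ R^o)/(_ _ e0)/nbhs_ballP[d /= d0 Hd] := c (sup E).
have [x Ex xd] := sup_adherent d0 sE.
have xs : x <= sup E by apply: ub_le_sup => //; case: sE.
have := Hd x; rewrite /ball /= ger0_norm ?subr_ge0// => /(_ _)/wrap[];
  first by lra.
rewrite !(ger0_norm (sqr_ge0 _)) => h.
have := le_lt_trans (ler_norm _) h; have := Er x Ex; lra.
Qed.

(** The sub-multiplicative part of the argument, for the numbers [a = |A x|],
    [b = |B x|], [p = |P x|], [q = |Q x|], [d = |<A^* B x, x>|] and
    [d2 = |<Q P x, x>|]. *)
Lemma orlicz_scalar_ineq {R : realType} (phi : R -> R) (r a b p q d d2 : R) :
  orlicz phi -> submultiplicative phi -> 0 <= r ->
  0 <= a -> 0 <= b -> 0 <= p -> 0 <= q -> 0 <= d -> 0 <= d2 ->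
  d <= a * b -> a ^+ 2 * b ^+ 2 <= 1 / 2 * d2 + (1 - 1 / 2) * (p * q) ->
  phi (d ^+ 2) <=
    1 / (1 + r) * (phi d * (1 / 2 * (phi (a ^+ 2) + phi (b ^+ 2)))) +
    r / (1 + r) * (1 / 2 * phi d2 +
                   1 / 2 * (1 / 2 * (phi (p ^+ 2) + phi (q ^+ 2)))).
Proof.
move=> ophi sphi r0 a0 b0 p0 q0 d0 d20 dab h.
have ab0 : 0 <= a * b by exact: mulr_ge0.
have E1 : phi (d * (a * b)) <= phi d * (1 / 2 * (phi (a ^+ 2) + phi (b ^+ 2))).
  apply: le_trans (sphi _ _ d0 ab0) _; apply: ler_wpM2l.
    exact: orlicz_ge0.
  exact: orlicz_mean.
have E2 : phi (a ^+ 2 * b ^+ 2) <=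
    1 / 2 * phi d2 + 1 / 2 * (1 / 2 * (phi (p ^+ 2) + phi (q ^+ 2))).
  apply: le_trans (orlicz_le ophi _ _ _ h) _;
    first by rewrite mulr_ge0 ?sqr_ge0.
  apply: le_trans (orlicz_conv ophi (1 / 2) _ _ _ _ d20 (mulr_ge0 p0 q0)) _.
  - lra.
  - lra.
  have := orlicz_mean _ _ _ ophi p0 q0; lra.
pose s := 1 / (1 + r).
have r1 : 0 < 1 + r by lra.
have s0 : 0 <= s by rewrite divr_ge0 ?ltW.
have s1 : s <= 1 by rewrite ler_pdivrMr//; lra.
have sr : 1 - s = r / (1 + r) by rewrite /s; field; rewrite gt_eqF.
have sle : d ^+ 2 <= s * (d * (a * b)) + (1 - s) * (a ^+ 2 * b ^+ 2).
  have h1 : d ^+ 2 <= d * (a * b) by rewrite expr2 ler_wpM2l.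
  have h2 : d ^+ 2 <= a ^+ 2 * b ^+ 2 by rewrite -exprMn lerXn2r.
  have := ler_wpM2l s0 h1; have : 0 <= 1 - s by lra.
  move=> /ler_wpM2l/(_ _ _ h2); lra.
apply: le_trans (orlicz_le ophi _ _ (sqr_ge0 d) sle) _.
apply: le_trans (orlicz_conv ophi s _ _ s0 s1 _ _) _.
- exact: mulr_ge0.
- by rewrite mulr_ge0 ?sqr_ge0.
by rewrite -sr lerD// ler_wpM2l// subr_ge0.
Qed.

(** * Berezin numbers *)

Section berezin.
Local Open Scope complex_scope.
Context {R : realType} {Omega : Type} {H : functional_hilbert R Omega}.
Implicit Types (u v w : H) (T S P Q : H -> H) (a : R) (c : R[i]).

Local Notation dot := (fh_dot H).
Local Notation nrm := (nrm H).
Local Notation rdot := (rdot H).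

(** Jensen's inequality for the functional calculus: [q] is a supporting line of
    [phi] at [<T u, u>], and [<q(T) u, u> = phi (<T u, u>)]. *)
Lemma cfc_jensen (phi : R -> R) T u : orlicz phi ->
  bounded_op T -> self_adjoint T -> positive_op T -> nrm u = 1 ->
  phi (rdot (T u) u) <= rdot (cfc phi T u) u.
Proof.
move=> ophi bT sT pT u1.
have [c Hc] := orlicz_supporting_line ophi (rdot (T u) u) (pT u).
have cT := cfcP _ _ bT sT pT (orlicz_continuous ophi).
pose q : {poly R} := (phi (rdot (T u) u))%:P - (- c)%:P * ('X - (rdot (T u)
  u)%:P).
have lT := bounded_op_linear bT.
have := cfc_ge_poly _ _ _ q u bT sT cT.
rewrite /q poly_opB poly_opM// poly_opB !poly_opC poly_opX//.
rewrite !(rdotDl, rdotNl, rdotZl) -nrm_sqr u1 => /(_ _)/wrap[].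
  move=> x Tx; have := Hc x (spectrum_ge0 _ _ bT sT pT Tx).
  by rewrite !hornerE; lra.
by lra.
Qed.

(** A real form of Buzano's inequality: [2 <a,e> e - a] has the norm of [a]. *)
Lemma buzano u v (e : H) : nrm e = 1 ->
  2 * (rdot u e * rdot v e) <= rdot u v + nrm u * nrm v.
Proof.
move=> e1; pose w := (2 * rdot u e)%:C *: e - u.
have nw : nrm w = nrm u.
  apply/eqP; rewrite -(@eqrXn2 _ 2) ?nrm_ge0//; apply/eqP; rewrite !nrm_sqr /w.
  rewrite !(rdotDl, rdotDr, rdotNl, rdotNr, rdotZl, rdotZr) (rdotC H e u).
  by rewrite -(nrm_sqr H e) e1; ring.
have := rdot_le w v; rewrite nw /w rdotDl rdotNl rdotZl (rdotC H e v); lra.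
Qed.

Lemma adjoint_dotl T u v : bounded_op T -> dot (adjoint T u) v = dot u (T v).
Proof. by move=> /adjointP[_ h]; rewrite (dotC H) -h -(dotC H). Qed.

Section gram.
Context {A : H -> H} (bA : bounded_op A).

Lemma bounded_gram : bounded_op (adjoint A \o A).
Proof. by apply: bounded_op_comp => //; case: (adjointP A bA). Qed.

Lemma self_adjoint_gram : self_adjoint (adjoint A \o A).
Proof. by move=> u v /=; rewrite adjoint_dotl//; case: (adjointP A bA) =>
  _ ->. Qed.

Lemma rdot_gram u : rdot ((adjoint A \o A) u) u = nrm (A u) ^+ 2.
Proof. by rewrite /rdot /= adjoint_dotl// nrm_sqr. Qed.

Lemma positive_gram : positive_op (adjoint A \o A).
Proof. by move=> u; rewrite rdot_gram sqr_ge0. Qed.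

Lemma abs_op_sqr : iter 2 (abs_op A) = adjoint A \o A.
Proof.
apply: (is_cfc_sqrtK _ _ bounded_gram self_adjoint_gram positive_gram).
apply: (cfcP _ _ bounded_gram self_adjoint_gram positive_gram).
exact/continuous_subspaceT/sqrt_continuous.
Qed.

Lemma abs_op_pow4 : iter 4 (abs_op A) = (adjoint A \o A) \o (adjoint A \o A).
Proof. by rewrite -abs_op_sqr. Qed.

End gram.

Lemma self_adjoint_sqr T : self_adjoint T -> self_adjoint (T \o T).
Proof. by move=> sT u v /=; rewrite !sT. Qed.

Lemma rdot_sqr T u : self_adjoint T -> rdot ((T \o T) u) u = nrm (T u) ^+ 2.
Proof. by move=> sT; rewrite /= (rdot_self_adjoint _ _ _ sT) nrm_sqr. Qed.

Lemma positive_sqr T : self_adjoint T -> positive_op (T \o T).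
Proof. by move=> sT u; rewrite rdot_sqr// sqr_ge0. Qed.

Section berezin_number.
Context (kernel_neq0 : forall l, repr_kernel H l != 0).
Local Notation k l := (normalized_kernel H l).

(** The only property of normalized kernels that the argument needs. *)
Lemma nrm_normalized_kernel l : nrm (k l) = 1.
Proof.
have k0 := kernel_neq0 l.
apply: complexI; rewrite -nrmE normrZ normfV normr_id mulVf//.
by rewrite normr_eq0.
Qed.

Lemma berezin_ubound T : bounded_op T ->
  has_ubound [set complex.Re `|dot (T (k l)) (k l)| | l in [set: Omega]].
Proof.
move=> /bounded_opP[_ [M M0 HM]]; exists M => _ [l _ <-].
apply: le_trans (cauchy_schwarz _ _) _; have := HM (k l).
by rewrite nrm_normalized_kernel !mulr1.
Qed.

Lemma le_ber T l : bounded_op T -> complex.Re `|dot (T (k l)) (k l)| <= ber T.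
Proof. by move=> bT; apply: ub_le_sup; [exact: berezin_ubound|exists l]. Qed.

Lemma rdot_le_ber T l : bounded_op T -> rdot (T (k l)) (k l) <= ber T.
Proof. by move=> bT; apply: le_trans (le_ber T l bT); exact: rdot_le_normc. Qed.

End berezin_number.

End berezin.

Theorem theorem3p6 (R : realType) (Omega : Type) (Omega0 : [set: Omega] !=set0)
  (H : functional_hilbert R Omega) (kernel_neq0 : forall l, repr_kernel H l != 0)
  (A B : H -> H) (bA : bounded_op A) (bB : bounded_op B)
  (f : R -> R) (f_ge0 : forall s, 0 < s < 1 -> 0 <= f s)
  (t : R) (t01 : 0 < t < 1)
  (phi : R -> R) (phi_orlicz : orlicz phi) (phi_sub : submultiplicative phi) :
  phi (ber (adjoint A \o B) ^+ 2) <=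
    1 / (2 * (1 + f t)) * phi (ber (adjoint A \o B))
      * ber (cfc phi (iter 2 (abs_op A)) \+ cfc phi (iter 2 (abs_op B)))
    + f t / (2 * (1 + f t))
      * (phi (ber (iter 2 (abs_op B) \o iter 2 (abs_op A)))
         + 1 / 2 * ber (cfc phi (iter 4 (abs_op A))
                        \+ cfc phi (iter 4 (abs_op B)))).
Proof.
have ft0 := f_ge0 t t01; move: (f t) ft0 => r r0.
rewrite !abs_op_pow4// !abs_op_sqr//.
set P := adjoint A \o A; set Q := adjoint B \o B.
have bP : bounded_op P := bounded_gram bA.
have bQ : bounded_op Q := bounded_gram bB.
have sP : self_adjoint P := self_adjoint_gram bA.
have sQ : self_adjoint Q := self_adjoint_gram bB.
have pP : positive_op P := positive_gram bA.
have pQ : positive_op Q := positive_gram bB.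
have bPP := bounded_op_comp _ _ bP bP; have bQQ := bounded_op_comp _ _ bQ bQ.
have sPP := self_adjoint_sqr _ sP; have sQQ := self_adjoint_sqr _ sQ.
have pPP := positive_sqr _ sP; have pQQ := positive_sqr _ sQ.
have bAB : bounded_op (adjoint A \o B).
  by apply: bounded_op_comp => //; case: (adjointP A bA).
have bcfc (T : H -> H) : bounded_op T -> self_adjoint T -> positive_op T ->
    bounded_op (cfc phi T).
  by move=> bT sT pT; case: (cfcP _ _ bT sT pT (orlicz_continuous phi_orlicz)).
have bsum (S T : H -> H) : bounded_op S -> bounded_op T -> bounded_op (S \+ T).
  move=> bS bT; have := bounded_op_lin _ _ 1 bS bT.
  by congr bounded_op; apply/funext => u /=; rewrite scale1r.
have sumE (S T : H -> H) u : rdot H ((S \+ T) u) u = rdot H (S u) u +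
  rdot H (T u) u.
  by rewrite /= rdotDl.
apply: orlicz_sqr_sup => //.
- split; last exact: berezin_ubound.
  by case: Omega0 => l _; eexists; exists l.
- by move=> _ [l _ <-]; exact: Re_normc_ge0.
move=> _ [l _ <-].
have x1 := nrm_normalized_kernel kernel_neq0 l.
have dle := le_ber kernel_neq0 _ l bAB.
have d2le := le_ber kernel_neq0 _ l (bounded_op_comp _ _ bQ bP).
have s1le := rdot_le_ber kernel_neq0 _ l (bsum _ _ (bcfc _ bP sP pP) (bcfc _ bQ
  sQ pQ)).
have s2le := rdot_le_ber kernel_neq0 _ l
  (bsum _ _ (bcfc _ bPP sPP pPP) (bcfc _ bQQ sQQ pQQ)).
rewrite !sumE in s1le s2le.
set x := normalized_kernel H l in x1 dle d2le s1le s2le *.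
have jP := cfc_jensen _ _ _ phi_orlicz bP sP pP x1.
have jQ := cfc_jensen _ _ _ phi_orlicz bQ sQ pQ x1.
have jPP := cfc_jensen _ _ _ phi_orlicz bPP sPP pPP x1.
have jQQ := cfc_jensen _ _ _ phi_orlicz bQQ sQQ pQQ x1.
rewrite rdot_gram// in jP; rewrite rdot_gram// in jQ.
rewrite rdot_sqr// in jPP; rewrite rdot_sqr// in jQQ.
have dAB : complex.Re `|fh_dot H ((adjoint A \o B) x) x| <=
  nrm H (A x) * nrm H (B x).
  by rewrite /= adjoint_dotl// mulrC cauchy_schwarz.
have d0 := Re_normc_ge0 (fh_dot H ((adjoint A \o B) x) x).
have d20 := Re_normc_ge0 (fh_dot H ((Q \o P) x) x).
have buz : nrm H (A x) ^+ 2 * nrm H (B x) ^+ 2 <=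
    1 / 2 * complex.Re `|fh_dot H ((Q \o P) x) x| +
    (1 - 1 / 2) * (nrm H (P x) * nrm H (Q x)).
  have := buzano (P x) (Q x) x x1; rewrite !rdot_gram//.
  have := rdot_le_normc ((Q \o P) x) x;
    rewrite /= (rdot_self_adjoint _ _ _ sQ); lra.
have a0 := nrm_ge0 H (A x); have b0 := nrm_ge0 H (B x).
have p0 := nrm_ge0 H (P x); have q0 := nrm_ge0 H (Q x).
apply: le_trans (orlicz_scalar_ineq _ _ _ _ _ _ _ _ phi_orlicz phi_sub r0
  (nrm_ge0 H (A x))
  (nrm_ge0 H (B x)) (nrm_ge0 H (P x)) (nrm_ge0 H (Q x)) d0 d20 dAB buz) _.
have r1 : 0 < 1 + r by lra.
have -> : forall c1 c2 b1 b2 : R, 1 / (2 * (1 + r)) * b1 * c1 +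
    r / (2 * (1 + r)) * (b2 + 1 / 2 * c2) = 1 / (1 + r) * (b1 * (1 / 2 * c1)) +
    r / (1 + r) * (1 / 2 * b2 + 1 / 2 * (1 / 2 * c2)).
  by move=> c1 c2 b1 b2; field; rewrite gt_eqF.
have half0 : 0 <= 1 / 2 :> R by lra.
apply: lerD; apply: ler_wpM2l; rewrite ?divr_ge0 ?(ltW r1)//.
  apply: ler_pM; first exact: orlicz_ge0.
  - by rewrite mulr_ge0// ?addr_ge0// orlicz_ge0// sqr_ge0.
  - exact: orlicz_le dle.
  - by apply: ler_wpM2l => //; apply: le_trans s1le; apply: lerD.
apply: lerD; apply: ler_wpM2l => //; first exact: orlicz_le d2le.
by apply: ler_wpM2l => //; apply: le_trans s2le; apply: lerD.
Qed.
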